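(* Let $\mathcal R$ be a commutative unital ring, and let $k\geqslant 1$ and $n\geqslant 0$ be integers. Every singular pure braid on $k$ strands with $n$ double points is equal, in the group algebra $\mathcal R\mathcal P_k$ of the pure braid group $\mathcal P_k$, to an $\mathcal R$-linear combination of combed singular pure braids on $k$ strands, each with $n$ double points.
   Context: $B_k$ is the braid group on $k$ strands with standard generators $\sigma_1,\dots,\sigma_{k-1}$, and $\mathcal P_k\subset B_k$ is the pure braid group. The product $\alpha\beta$ means ''$\alpha$ on top of $\beta$''. Singular pure braids. A singular pure braid is a pure braid whose strands are allowed to intersect transversally at a finite (possibly zero) number of double points. It is regarded as an element of $\mathcal R\mathcal P_k$ by replacing each double point by (positive crossing) $-$ (negative crossing). Equivalently, a singular pure braid with $n$ double points is a finite product of factors of the form $\sigma_i^{\pm1}$ and $\sigma_i-\sigma_i^{-1}$, with exactly $n$ factors of the second kind, whose underlying permutation (each factor $\sigma_i^{\pm 1}$ or $\sigma_i-\sigma_i^{-1}$ having underlying permutation $(i\ i{+}1)$) is trivial. Free subgroups. For $1\leqslant i\leqslant k-1$, $F_i\subset\mathcal P_k$ denotes the subgroup of $i$-free braids: those which can be drawn so that all strands other than the $(i+1)$-st are vertical and straight, while the $(i+1)$-st strand braids around the $i$ strands to its left. It is free of rank $i$ with free generators $x_{i+1,j}$, $1\leqslant j\leqslant i$, where in $x_{i+1,j}$ the $(i+1)$-st strand links once around the $j$-th strand; explicitly $x_{i+1,j}=\sigma_j^{-1}\cdots\sigma_{i-1}^{-1}\,\sigma_i^2\,\sigma_{i-1}\cdots\sigma_j$.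 An $i$-free singular braid is a singular pure braid in which all strands other than the $(i+1)$-st are vertical and straight and the $(i+1)$-st strand moves around, and may meet in double points, the $i$ strands to its left. Equivalently, an $i$-free singular braid with $n$ double points is an element of $\mathcal R F_i$ of the form $w_0(x_{i+1,j_1}-1)w_1(x_{i+1,j_2}-1)\cdots(x_{i+1,j_n}-1)w_n$ with $w_0,\dots,w_n\in F_i$. A singular pure braid on $k$ strands is combed if it is written as a product $B_{k-1}B_{k-2}\cdots B_1$ where each $B_i$ is an $i$-free singular braid; its number of double points is the sum of the numbers of double points of the $B_i$. *)

(* Defs.v *)
From HB Require Import structures.
From mathcomp Require Import all_boot all_order all_algebra all_fingroup.
From mathcomp Require Import finmap generic_quotient boolp.
From mathcomp Require Import monalg zify.

Set Implicit Arguments.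
Unset Strict Implicit.
Unset Printing Implicit Defensive.

Import GRing.Theory.

Local Open Scope quotient_scope.
Local Open Scope ring_scope.

(* The ring structure of [monalg] on [{malg R[G]}] is restricted to monoids in
   which only 1 is invertible, so it never applies to a nontrivial group; the
   convolution product is therefore put on an alias, for any group [G] and any
   ring [R], possibly the zero ring. *)
Section GroupAlgebra.
Context (R : pzRingType) (G : groupType).

Definition group_algebra : Type := {malg R[G]}.

HB.instance Definition _ := GRing.Zmodule.on group_algebra.

Implicit Types (x y z : group_algebra) (g h : G).

Definition ga_of (g : G) : group_algebra := << 1 *g g >>.

Definition ga_mul x y : group_algebra :=
  \sum_(g <- msupp x) \sum_(h <- msupp y) << x@_g * y@_h *g (g * h)%g >>.

Definition ga_scale (c : R) x : group_algebra :=
  \sum_(g <- msupp x) << c * x@_g *g g >>.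

Lemma ga_mulw (d1 d2 : {fset G}) x y :
  (msupp x `<=` d1)%fset -> (msupp y `<=` d2)%fset ->
  ga_mul x y = \sum_(g <- d1) \sum_(h <- d2) << x@_g * y@_h *g (g * h)%g >>.
Proof.
move=> le1 le2; rewrite /ga_mul (big_fset_incl _ le1) /=.
  apply/eq_bigr=> g _; apply/big_fset_incl => // h _ /mcoeff_outdom ->.
  by rewrite mulr0 monalgU0.
move=> g _ /mcoeff_outdom xg.
by rewrite big1 => // h _; rewrite xg mul0r monalgU0.
Qed.

Lemma ga_mulDl : left_distributive ga_mul +%R.
Proof.
move=> x y z.
rewrite (@ga_mulw (msupp x `|` msupp y)%fset (msupp z) (x + y)) //;
  last exact: msuppD_le.
rewrite (@ga_mulw (msupp x `|` msupp y)%fset (msupp z) x) ?fsubsetUl //.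
rewrite (@ga_mulw (msupp x `|` msupp y)%fset (msupp z) y) ?fsubsetUr //.
rewrite -big_split /=; apply/eq_bigr=> g _.
rewrite -big_split /=; apply/eq_bigr=> h _.
by rewrite mcoeffD mulrDl monalgUD.
Qed.

Lemma ga_mulDr : right_distributive ga_mul +%R.
Proof.
move=> x y z.
rewrite (@ga_mulw (msupp x) (msupp y `|` msupp z)%fset _ (y + z)) //;
  last exact: msuppD_le.
rewrite (@ga_mulw (msupp x) (msupp y `|` msupp z)%fset _ y) ?fsubsetUl //.
rewrite (@ga_mulw (msupp x) (msupp y `|` msupp z)%fset _ z) ?fsubsetUr //.
rewrite -big_split /=; apply/eq_bigr=> g _.
rewrite -big_split /=; apply/eq_bigr=> h _.
by rewrite mcoeffD mulrDr monalgUD.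
Qed.

Lemma ga_mul0l : left_zero 0 ga_mul.
Proof. by move=> x; rewrite /ga_mul msupp0 big_seq_fset0. Qed.

Lemma ga_mul0r : right_zero 0 ga_mul.
Proof.
by move=> x; rewrite /ga_mul big1 // => g _; rewrite msupp0 big_seq_fset0.
Qed.

Lemma ga_mulUU (a b : R) g h :
  ga_mul << a *g g >> << b *g h >> = << a * b *g (g * h)%g >>.
Proof.
rewrite (@ga_mulw [fset g]%fset [fset h]%fset) ?msuppU_le //.
by rewrite !big_seq_fset1 !mcoeffUU.
Qed.

Lemma ga_ind (P : group_algebra -> Prop) :
  P 0 -> (forall x y, P x -> P y -> P (x + y)) ->
  (forall a g, P << a *g g >>) -> forall x, P x.
Proof.
move=> P0 PD PU x; rewrite [x]monalgE.
by apply: (big_ind P) => // g _; apply: PU.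
Qed.

Lemma ga_mulA : associative ga_mul.
Proof.
move=> x y z; elim/ga_ind: x => [|x1 x2 IH1 IH2|a g].
- by rewrite !ga_mul0l.
- by rewrite !ga_mulDl IH1 IH2.
elim/ga_ind: y => [|y1 y2 IH1 IH2|b h].
- by rewrite !(ga_mul0l, ga_mul0r).
- by rewrite !(ga_mulDl, ga_mulDr) IH1 IH2.
elim/ga_ind: z => [|z1 z2 IH1 IH2|c l].
- by rewrite !ga_mul0r.
- by rewrite !ga_mulDr IH1 IH2.
by rewrite !ga_mulUU mulrA mulgA.
Qed.

Lemma ga_mul1l : left_id (ga_of 1%g) ga_mul.
Proof.
elim/ga_ind=> [|x y IHx IHy|a g]; first exact: ga_mul0r.
  by rewrite ga_mulDr IHx IHy.
by rewrite ga_mulUU mul1r mul1g.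
Qed.

Lemma ga_mul1r : right_id (ga_of 1%g) ga_mul.
Proof.
elim/ga_ind=> [|x y IHx IHy|a g]; first exact: ga_mul0l.
  by rewrite ga_mulDl IHx IHy.
by rewrite ga_mulUU mulr1 mulg1.
Qed.

HB.instance Definition _ := GRing.Zmodule_isPzRing.Build group_algebra
  ga_mulA ga_mul1l ga_mul1r ga_mulDl ga_mulDr.

Lemma ga_scaleE c x g : (ga_scale c x)@_g = c * x@_g.
Proof.
rewrite {2}[x]monalgE !raddf_sum mulr_sumr.
by apply/eq_bigr=> h _; rewrite /= !mcoeffU mulrnAr.
Qed.

Lemma ga_scaleA a b x : ga_scale a (ga_scale b x) = ga_scale (a * b) x.
Proof. by apply/malgP=> g; rewrite !ga_scaleE mulrA. Qed.

Lemma ga_scale1 : left_id 1 ga_scale.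
Proof. by move=> x; apply/malgP=> g; rewrite ga_scaleE mul1r. Qed.

Lemma ga_scaleDr : right_distributive ga_scale +%R.
Proof. by move=> c x y; apply/malgP=> g; rewrite !(mcoeffD, ga_scaleE) mulrDr. Qed.

Lemma ga_scaleDl x : {morph ga_scale^~ x : a b / a + b}.
Proof. by move=> a b; apply/malgP=> g; rewrite !(mcoeffD, ga_scaleE) mulrDl. Qed.

HB.instance Definition _ := GRing.Zmodule_isLmodule.Build R group_algebra
  ga_scaleA ga_scale1 ga_scaleDr ga_scaleDl.

End GroupAlgebra.

Arguments ga_of R {G} g.

Definition ga_map (R : pzRingType) (G H : groupType) (f : G -> H)
    (x : group_algebra R G) : group_algebra R H :=
  \sum_(g <- msupp x) << x@_g *g f g >>.

Section GroupAlgebraMap.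
Context (R : pzRingType) (G H : groupType) (f : G -> H).
Implicit Types (x y : group_algebra R G).

Lemma ga_mapw (d : {fset G}) x : (msupp x `<=` d)%fset ->
  ga_map f x = \sum_(g <- d) << x@_g *g f g >>.
Proof.
move=> le; rewrite /ga_map (big_fset_incl _ le) //= => g _ /mcoeff_outdom ->.
by rewrite monalgU0.
Qed.

Lemma ga_mapD x y : ga_map f (x + y) = ga_map f x + ga_map f y.
Proof.
rewrite (@ga_mapw (msupp x `|` msupp y)%fset (x + y)) ?msuppD_le //.
rewrite (@ga_mapw (msupp x `|` msupp y)%fset x) ?fsubsetUl //.
rewrite (@ga_mapw (msupp x `|` msupp y)%fset y) ?fsubsetUr //.
by rewrite -big_split /=; apply/eq_bigr=> g _; rewrite mcoeffD monalgUD.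
Qed.

Lemma ga_map0 : ga_map f (0 : group_algebra R G) = 0.
Proof. by rewrite /ga_map msupp0 big_seq_fset0. Qed.

Lemma ga_mapU (c : R) g : ga_map f << c *g g >> = << c *g f g >>.
Proof. by rewrite (ga_mapw msuppU_le) big_seq_fset1 mcoeffUU. Qed.

Lemma ga_mapM : {morph f : g h / (g * h)%g >-> (g * h)%g} ->
  {morph ga_map (R := R) f : x y / x * y >-> x * y}.
Proof.
move=> fM x y; elim/ga_ind: x => [|x1 x2 IH1 IH2|a g].
- by rewrite mul0r ga_map0 mul0r.
- by rewrite mulrDl !ga_mapD mulrDl IH1 IH2.
elim/ga_ind: y => [|y1 y2 IH1 IH2|b h].
- by rewrite mulr0 ga_map0 mulr0.
- by rewrite mulrDr !ga_mapD mulrDr IH1 IH2.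
rewrite [X in ga_map f X]ga_mulUU !ga_mapU fM.
by rewrite [RHS]ga_mulUU.
Qed.

Lemma mcoeff_ga_map x g : injective f -> (ga_map f x)@_(f g) = x@_g.
Proof.
move=> fI; elim/ga_ind: x => [|x y IHx IHy|c h].
- by rewrite ga_map0 !mcoeff0.
- by rewrite ga_mapD !mcoeffD IHx IHy.
by rewrite ga_mapU !mcoeffU (inj_eq fI).
Qed.

Lemma ga_map_inj : injective f -> injective (ga_map (R := R) f).
Proof.
move=> fI x y e; apply/malgP=> g.
by rewrite -(mcoeff_ga_map x g fI) e mcoeff_ga_map.
Qed.

End GroupAlgebraMap.

Inductive gen_by (G : groupType) (A : G -> Prop) : G -> Prop :=
| gen_by_gen g of A g : gen_by A g
| gen_by_1 : gen_by A 1%g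
| gen_by_M g h of gen_by A g & gen_by A h : gen_by A (g * h)%g
| gen_by_V g of gen_by A g : gen_by A (g^-1)%g.

Section Braid.
Variable k : nat.

(* The letter [(true, i)] is the standard generator usually written
   sigma_(i+1), and [(false, i)] is its inverse. *)
Definition braid_word := seq (bool * 'I_k.-1).

Inductive braid_eq : braid_word -> braid_word -> Prop :=
| braid_eq_refl w : braid_eq w w
| braid_eq_sym v w of braid_eq v w : braid_eq w v
| braid_eq_trans u v w of braid_eq u v & braid_eq v w : braid_eq u w
| braid_eq_cat v v' w w' of braid_eq v v' & braid_eq w w' :
    braid_eq (v ++ w) (v' ++ w')
| braid_eq_cancel b i : braid_eq [:: (b, i); (~~ b, i)] [::]
| braid_eq_far (i j : 'I_k.-1) of (i.+1 < j)%N :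
    braid_eq [:: (true, i); (true, j)] [:: (true, j); (true, i)]
| braid_eq_near (i j : 'I_k.-1) of j = i.+1 :> nat :
    braid_eq [:: (true, i); (true, j); (true, i)]
             [:: (true, j); (true, i); (true, j)].

Definition braid_eqb : rel braid_word := fun v w => `[< braid_eq v w >].

Lemma braid_eqb_refl : reflexive braid_eqb.
Proof. by move=> w; apply/asboolP/braid_eq_refl. Qed.

Lemma braid_eqb_sym : symmetric braid_eqb.
Proof. by move=> v w; apply/asboolP/asboolP; apply: braid_eq_sym. Qed.

Lemma braid_eqb_trans : transitive braid_eqb.
Proof.
by move=> v u w /asboolP uv /asboolP vw; apply/asboolP/(braid_eq_trans uv).
Qed.

Canonical braid_equiv :=
  EquivRel braid_eqb braid_eqb_refl braid_eqb_sym braid_eqb_trans.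

Definition braid : Type := {eq_quot braid_equiv}.

HB.instance Definition _ := Choice.on braid.
HB.instance Definition _ := EqQuotient.on braid.

Lemma braidW (P : braid -> Prop) : (forall w, P (\pi_braid w)) -> forall a, P a.
Proof. by move=> Pw a; rewrite -[a]reprK. Qed.

Lemma braidP v w : reflect (braid_eq v w) (\pi_braid v == \pi_braid w).
Proof. by rewrite eqquotE; apply: asboolP. Qed.

Lemma braid_eq_repr w : braid_eq (repr (\pi_braid w)) w.
Proof. by apply/braidP; rewrite reprK. Qed.

Definition inv_word (w : braid_word) : braid_word :=
  rev [seq (~~ l.1, l.2) | l <- w].

Lemma inv_word_cat v w : inv_word (v ++ w) = inv_word w ++ inv_word v.
Proof. by rewrite /inv_word map_cat rev_cat. Qed.

Lemma inv_wordK : involutive inv_word.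
Proof.
move=> w; rewrite /inv_word map_rev revK -map_comp -[RHS]map_id.
by apply: eq_map => -[b i] /=; rewrite negbK.
Qed.

Lemma braid_eq_mulV w : braid_eq (w ++ inv_word w) [::].
Proof.
elim: w => [|[b i] w IHw]; first exact: braid_eq_refl.
rewrite -cat1s inv_word_cat -catA.
apply: (@braid_eq_trans _ ([:: (b, i)] ++ inv_word [:: (b, i)])).
  apply: braid_eq_cat; first exact: braid_eq_refl.
  rewrite catA -[X in braid_eq _ X]cat0s.
  exact/(braid_eq_cat IHw)/braid_eq_refl.
exact: braid_eq_cancel.
Qed.

Lemma braid_eq_Vmul w : braid_eq (inv_word w ++ w) [::].
Proof. by rewrite -{2}[w]inv_wordK; apply: braid_eq_mulV. Qed.

Lemma braid_eq_inv v w : braid_eq v w -> braid_eq (inv_word v) (inv_word w).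
Proof.
move=> vw; apply: (@braid_eq_trans _ (inv_word v ++ w ++ inv_word w)).
  rewrite -[X in braid_eq X _]cats0; apply: braid_eq_cat.
    exact: braid_eq_refl.
  exact/braid_eq_sym/braid_eq_mulV.
rewrite catA -[X in braid_eq _ X]cat0s.
apply: braid_eq_cat; last exact: braid_eq_refl.
apply: braid_eq_trans (braid_eq_Vmul v).
by apply: braid_eq_cat; [exact: braid_eq_refl | exact: braid_eq_sym].
Qed.

Definition braid_one : braid := \pi_braid [::].
Definition braid_mul (a b : braid) : braid := \pi_braid (repr a ++ repr b).
Definition braid_inv (a : braid) : braid := \pi_braid (inv_word (repr a)).

Lemma pi_braid_mul v w :
  braid_mul (\pi_braid v) (\pi_braid w) = \pi_braid (v ++ w).
Proof. by apply/eqP/braidP/braid_eq_cat; apply: braid_eq_repr. Qed.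

Lemma pi_braid_inv w : braid_inv (\pi_braid w) = \pi_braid (inv_word w).
Proof. by apply/eqP/braidP/braid_eq_inv/braid_eq_repr. Qed.

Lemma braid_mulA : associative braid_mul.
Proof.
elim/braidW=> u; elim/braidW=> v; elim/braidW=> w.
by rewrite !pi_braid_mul catA.
Qed.

Lemma braid_mul1l : left_id braid_one braid_mul.
Proof. by elim/braidW=> w; rewrite pi_braid_mul. Qed.

Lemma braid_mul1r : right_id braid_one braid_mul.
Proof. by elim/braidW=> w; rewrite pi_braid_mul cats0. Qed.

Lemma braid_mulVl : left_inverse braid_one braid_inv braid_mul.
Proof.
elim/braidW=> w; rewrite pi_braid_inv pi_braid_mul.
exact/eqP/braidP/braid_eq_Vmul.
Qed.

Lemma braid_mulVr : right_inverse braid_one braid_inv braid_mul.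
Proof.
elim/braidW=> w; rewrite pi_braid_inv pi_braid_mul.
exact/eqP/braidP/braid_eq_mulV.
Qed.

HB.instance Definition _ := isGroup.Build braid
  braid_mulA braid_mul1l braid_mul1r braid_mulVl braid_mulVr.

Definition sigma (i : 'I_k.-1) : braid := \pi_braid [:: (true, i)].

Lemma lt_pred_strand (i : 'I_k.-1) : (i.+1 < k)%N.
Proof. by case: k i => [|[|m]] i; case: i. Qed.

Definition adj_tperm (i : 'I_k.-1) : 'S_k :=
  tperm (Ordinal (ltnW (lt_pred_strand i))) (Ordinal (lt_pred_strand i)).

Definition word_perm (w : braid_word) : 'S_k :=
  (\prod_(l <- w) adj_tperm l.2)%g.

Lemma word_perm_cat v w : word_perm (v ++ w) = (word_perm v * word_perm w)%g.
Proof. by rewrite /word_perm big_cat. Qed.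

Lemma word_perm_eq v w : braid_eq v w -> word_perm v = word_perm w.
Proof.
elim=> {v w} //.
- by move=> u v w _ -> _ ->.
- by move=> v v' w w' _ IHv _ IHw; rewrite !word_perm_cat IHv IHw.
- by move=> b i; rewrite /word_perm !big_cons big_nil /= mulg1 tperm2.
- move=> i j ij; rewrite /word_perm !big_cons !big_nil /= !mulg1.
  suff e : (adj_tperm j ^ adj_tperm i)%g = adj_tperm j.
    by rewrite -{1}e conjgE !mulgA mulgV mul1g.
  by rewrite /adj_tperm tpermJ !tpermD // -val_eqE /=; lia.
- move=> i j ij; rewrite /word_perm !big_cons !big_nil /= !mulg1.
  transitivity (adj_tperm j ^ adj_tperm i)%g; first by rewrite conjgE tpermV.
  transitivity (adj_tperm i ^ adj_tperm j)%g; last by rewrite conjgE tpermV.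
  rewrite /adj_tperm !tpermJ.
  have -> : Ordinal (ltnW (lt_pred_strand j)) = Ordinal (lt_pred_strand i).
    exact: val_inj.
  by rewrite tpermR tpermL !tpermD // -val_eqE /=; lia.
Qed.

Definition braid_perm (b : braid) : 'S_k := word_perm (repr b).

Lemma braid_perm_pi w : braid_perm (\pi_braid w) = word_perm w.
Proof. exact/word_perm_eq/braid_eq_repr. Qed.

Lemma braid_permM : {morph braid_perm : a b / (a * b)%g >-> (a * b)%g}.
Proof.
elim/braidW=> v; elim/braidW=> w.
transitivity (braid_perm (\pi_braid (v ++ w))).
  exact: congr1 (pi_braid_mul v w).
by rewrite !braid_perm_pi word_perm_cat.
Qed.

Lemma braid_perm1 : braid_perm 1%g = 1%g.
Proof. by rewrite [LHS]braid_perm_pi /word_perm big_nil. Qed.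

Lemma braid_permV b : braid_perm b^-1%g = (braid_perm b)^-1%g.
Proof.
by apply: (mulgI (braid_perm b)); rewrite -braid_permM !mulgV braid_perm1.
Qed.

Lemma braid_perm_sigma i : braid_perm (sigma i) = adj_tperm i.
Proof. by rewrite braid_perm_pi /word_perm big_cons big_nil mulg1. Qed.

Definition is_pure : pred braid := fun b => braid_perm b == 1%g.

Lemma is_pure_group : group_closed is_pure.
Proof.
rewrite /is_pure; split=> [|a b]; rewrite !unfold_in /= ?braid_perm1 //.
by move=> /eqP pa /eqP pb; rewrite braid_permM braid_permV pa pb mulgV.
Qed.

Definition pure_braid : Type := {b : braid | is_pure b}.

HB.instance Definition _ := SubChoice.on pure_braid.
HB.instance Definition _ :=
  SubChoice_isSubGroup.Build braid is_pure pure_braid is_pure_group.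

Definition x_braid (i : 'I_k.-1) (j : 'I_i.+1) : braid :=
  let d := (\prod_(a < k.-1 | (j <= a < i)%N) (sigma a)^-1)%g in
  (d * sigma i ^+ 2 * d^-1)%g.

Lemma x_braid_pure (i : 'I_k.-1) (j : 'I_i.+1) : is_pure (x_braid j).
Proof.
rewrite /is_pure /x_braid !braid_permM !braid_permV braid_perm_sigma tperm2.
by rewrite mulg1 mulgV.
Qed.

(* With indices shifted to start from 0, this is the free generator usually
   written x_(i+2, j+1), in which strand i+2 links strand j+1. *)
Definition x_gen (i : 'I_k.-1) (j : 'I_i.+1) : pure_braid :=
  Sub (x_braid j) (x_braid_pure j).

(* [i_free i] is the subgroup of (i+1)-free braids. *)
Definition i_free (i : 'I_k.-1) : pure_braid -> Prop :=
  gen_by (fun g => exists j : 'I_i.+1, g = x_gen j).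

Inductive singular_letter :=
| Crossing of bool & 'I_k.-1
| DoublePoint of 'I_k.-1.

Definition is_double (l : singular_letter) : bool :=
  if l is DoublePoint _ then true else false.

Definition letter_perm (l : singular_letter) : 'S_k :=
  match l with Crossing _ i | DoublePoint i => adj_tperm i end.

Section Singular.
Variable R : pzRingType.

Definition letter_val (l : singular_letter) : group_algebra R braid :=
  match l with
  | Crossing true i => ga_of R (sigma i)
  | Crossing false i => ga_of R (sigma i)^-1%g
  | DoublePoint i => ga_of R (sigma i) - ga_of R (sigma i)^-1%g
  end.

Definition pure_incl :
  group_algebra R pure_braid -> group_algebra R braid := ga_map val.

Lemma pure_incl_inj : injective pure_incl.
Proof. exact/ga_map_inj/val_inj. Qed.

Lemma pure_inclM : {morph pure_incl : x y / x * y}.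
Proof. by apply: ga_mapM => g h; apply: valM. Qed.

Lemma prod_letter_val (w : seq singular_letter) :
  exists2 s : seq (R * braid),
    all (fun p => braid_perm p.2 == (\prod_(l <- w) letter_perm l)%g) s
    & \prod_(l <- w) letter_val l = \sum_(p <- s) << p.1 *g p.2 >>.
Proof.
elim: w => [|l w [s /allP sP e]].
  exists [:: (1, 1%g)]; first by rewrite /= big_nil braid_perm1 eqxx.
  by rewrite big_nil big_cons big_nil addr0.
have [t tP et] : exists2 t : seq (R * braid),
    all (fun p => braid_perm p.2 == letter_perm l) t
    & letter_val l = \sum_(p <- t) << p.1 *g p.2 >>.
  case: l => [[] i|i] /=.
  - exists [:: (1, sigma i)]; first by rewrite /= braid_perm_sigma eqxx.
    by rewrite big_cons big_nil addr0.
  - exists [:: (1, (sigma i)^-1%g)].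
      by rewrite /= braid_permV braid_perm_sigma tpermV eqxx.
    by rewrite big_cons big_nil addr0.
  exists [:: (1, sigma i); (- 1, (sigma i)^-1%g)].
    by rewrite /= braid_permV braid_perm_sigma tpermV eqxx.
  by rewrite !big_cons big_nil addr0 /= monalgUN.
move/allP: tP => tP.
exists [seq (p.1 * q.1, (p.2 * q.2)%g) | p <- t, q <- s].
  apply/allP=> _ /allpairsP[[p q] [/= /tP/eqP ep /sP/eqP eq ->]] /=.
  by rewrite braid_permM ep eq big_cons.
rewrite big_cons et e big_allpairs_dep /= mulr_suml.
apply: eq_bigr => p _; rewrite mulr_sumr; apply: eq_bigr => q _.
exact: ga_mulUU.
Qed.

Lemma pure_incl_ex (w : seq singular_letter) :
  (\prod_(l <- w) letter_perm l)%g = 1%g ->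
  exists x, pure_incl x = \prod_(l <- w) letter_val l.
Proof.
have [s + ->] := prod_letter_val w => + w1; rewrite w1 {w w1}.
elim: s => [|[c b] s IHs] /=.
  by exists 0; rewrite /pure_incl ga_map0 big_nil.
move=> /andP[pb /IHs[x ex]].
exists (<< c *g (Sub b pb : pure_braid) >> + x).
by rewrite /pure_incl ga_mapD ga_mapU -/(pure_incl x) ex big_cons.
Qed.

(* The factors of a singular pure braid need not be pure, so the product is
   taken over the full braid group; by [pure_incl_ex] and [pure_incl_inj] it
   comes from exactly one element over the pure braid group. *)
Definition singular_pure_braid (n : nat)
    (x : group_algebra R pure_braid) : Prop :=
  exists w : seq singular_letter,
    [/\ (\prod_(l <- w) letter_perm l)%g = 1%g,
        count is_double w = n
      & pure_incl x = \prod_(l <- w) letter_val l].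

Definition i_free_singular (i : 'I_k.-1) (n : nat)
    (x : group_algebra R pure_braid) : Prop :=
  exists (j : 'I_n -> 'I_i.+1) (w : 'I_n.+1 -> pure_braid),
    (forall m, i_free i (w m)) /\
    x = ga_of R (w ord0) *
        \prod_(m < n) ((ga_of R (x_gen (j m)) - 1) *
                       ga_of R (w (lift ord0 m))).

(* [rev_ord] puts the factor of largest index first. *)
Definition combed (n : nat) (x : group_algebra R pure_braid) : Prop :=
  exists (d : 'I_k.-1 -> nat) (B : 'I_k.-1 -> group_algebra R pure_braid),
    [/\ forall i, i_free_singular i (d i) (B i),
        (\sum_(i < k.-1) d i)%N = n
      & x = \prod_(i < k.-1) B (rev_ord i)].

End Singular.

End Braid.

(* Main.v *)
Require Import Defs.
From mathcomp Require Import all_boot all_order all_algebra all_fingroup.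
From mathcomp Require Import generic_quotient monalg zify.

Set Implicit Arguments.
Unset Strict Implicit.
Unset Printing Implicit Defensive.

(** Let [F_i] be the free group of the strand at position [i.+1] around the
    strands to its left and let [I] be its augmentation ideal, whose [n]-th
    power is spanned by the free singular braids with [n] double points.  The
    crossings [s] of the strands to the left normalise [F_i], and conjugation
    by [s] and by [s^-1] agree on the abelianisation of [F_i], because both
    exchange the same two classes of generators ([xg_conj]).  Hence for [u] in
    [I^n] the elements [s u s^-1] and [s^-1 u s] of [I^n] differ by an element
    of [I^(n+1)] ([free_word_cj]).  This is what lets a double point go past a
    free singular braid:

      (s - s^-1) u = (s u s^-1) (s - s^-1) + (s u s^-1 - s^-1 u s) s^-1,

    where both terms on the right have as many double points as the left side.

    The braid group on strands [0, ..., i.+1] is the union of the cosets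
    [r_j F_i B], where [B] is the braid group on the strands [0, ..., i] and
    [r_j = s_j^-1 ... s_i^-1] with [j <= i.+1].  A letter multiplied on the
    left of [r_j] either passes through it as a letter of [B], or changes [j]
    and leaves behind an element of [F_i]; a double point then leaves a
    multiple of [x - 1] with [x] a generator of [F_i].  So, by induction on its
    length, every singular word with [n] double points is a combination of
    elements [r_j u v], with [u] free singular, [v] a singular word on the
    strands [0, ..., i] and [n] double points in all ([lower_word_coset]).
    These rewritings preserve the underlying permutation, so starting from a
    pure word only the terms with [r_j = 1] and [v] pure occur
    ([pure_lower_word]): [r_j] moves the last strand for [j <= i] and [v] does
    not.  Applying the same to [v] combs the word ([pure_word_combed]).

    The rewriting takes place in the group algebra of the full braid group,
    since singular letters are not pure.  The result is carried back to the
    pure braid group at the end, where the inclusion of group algebras is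
    injective. *)

Import GRing.Theory.

Local Open Scope quotient_scope.

(** * Conjugation in the braid group *)

Section BraidRelation.
Local Open Scope group_scope.
Context (G : groupType) (s t : G) (st : s * t * s = t * s * t).

Lemma braid_rel_conj : s ^ t^-1 = t ^ s.
Proof.
apply: (mulgI s); rewrite !conjgE invgK !mulgA mulgV mul1g.
by apply: (mulIg t); rewrite mulgVK.
Qed.

Lemma braid_rel_shift : t * (s^-1 * t^-1) = s^-1 * t^-1 * s.
Proof.
have := congr1 (fun g => g^-1) braid_rel_conj.
by rewrite !conjgE !invgM !invgK -!mulgA.
Qed.

Lemma braid_rel_commute : commute s (t * s * s * t).
Proof.
rewrite /commute !mulgA st -!mulgA; congr (_ * (_ * _)).
by rewrite !mulgA st.
Qed.

End BraidRelation.

Section BraidGenerators.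
Local Open Scope group_scope.
Variable k : nat.
Implicit Types (a b i j m n : nat) (g : braid k).

(** Generators indexed by all natural numbers, trivial out of range, so that
    products over index intervals and shifts of indices need no casts. *)
Definition gn a : braid k := if insub a is Some i then sigma i else 1.

Lemma gn_sigma (i : 'I_k.-1) : gn i = sigma i.
Proof. by rewrite /gn insubT //= => lt; congr sigma; apply: val_inj. Qed.

Lemma mul_pi (v w : braid_word k) :
  \pi_(braid k) v * \pi_(braid k) w = \pi_(braid k) (v ++ w).
Proof. exact: pi_braid_mul. Qed.

Lemma gn_far a b : a.+1 < b -> commute (gn a) (gn b).
Proof.
move=> ab; rewrite /gn.
case: insubP => [i _ ia|_]; last exact/commute_sym/commute1.
case: insubP => [j _ jb|_]; last exact: commute1.
rewrite /commute /sigma !mul_pi; apply/eqP/braidP.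
by apply: braid_eq_far; rewrite ia jb.
Qed.

Lemma gn_near a : a.+1 < k.-1 ->
  gn a * gn a.+1 * gn a = gn a.+1 * gn a * gn a.+1.
Proof.
move=> ak; rewrite /gn; case: insubP => [i _ ia|]; last by rewrite ltnW.
case: insubP => [j _ jb|]; last by rewrite ak.
rewrite /sigma !mul_pi; apply/eqP/braidP.
by apply: braid_eq_near; rewrite ia jb.
Qed.

Lemma gn_commute a b : (a.+1 < b) || (b.+1 < a) -> commute (gn a) (gn b).
Proof. by case/orP=> /gn_far // /commute_sym. Qed.

(** Both the conjugators in the free generators, as [desc j i], and the coset
    representatives [r_j], as [desc j i.+1]. *)
Definition desc m n : braid k := \prod_(m <= a < n) (gn a)^-1.

Lemma desc_nil m n : n <= m -> desc m n = 1.
Proof. by move=> nm; rewrite /desc big_geq. Qed.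

Lemma desc_recl m n : m < n -> desc m n = (gn m)^-1 * desc m.+1 n.
Proof. by move=> mn; rewrite /desc big_ltn. Qed.

Lemma desc_commute g m n :
  (forall a, m <= a < n -> commute g (gn a)) -> commute g (desc m n).
Proof.
move=> gC; rewrite /desc big_seq.
apply: (big_ind (fun h => commute g h)) => [|x y gx gy|a].
- exact: commute1.
- exact: commuteM.
by rewrite mem_index_iota => /gC; apply: commuteV.
Qed.

(** Only the factors of index [a.-1] and [a] matter, and for them this is
    [t s^-1 t^-1 = s^-1 t^-1 s]; the generator meets the earlier factors as
    [gn a] and the later ones as [gn a.-1], both at distance at least two. *)
Lemma desc_shift j a n : j < a -> a < n -> n <= k.-1 ->
  gn a * desc j n = desc j n * gn a.-1.
Proof.
case: a => // a ja an nk /=.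
have -> : desc j n = desc j a * ((gn a)^-1 * (gn a.+1)^-1) * desc a.+2 n.
  rewrite /desc (big_cat_nat (n := a)) //=; last by lia.
  rewrite [\prod_(a <= _ < _) _]big_ltn ?(ltnW an) //.
  by rewrite [X in _ * (_ * X)]big_ltn // -!mulgA.
have /commute_sym e1 : commute (gn a.+1) (desc j a).
  by apply: desc_commute => b bj; apply: gn_commute; lia.
have e2 : commute (gn a) (desc a.+2 n).
  by apply: desc_commute => b bj; apply: gn_commute; lia.
rewrite !mulgA -e1 -!mulgA -e2; congr (_ * _); rewrite !mulgA; congr (_ * _).
rewrite -!mulgA; rewrite (braid_rel_shift (gn_near _)) ?mulgA //; lia.
Qed.

Definition xg i j : braid k := (gn i ^+ 2) ^ (desc j i)^-1.

(** The two linked strands can be brought together by moving either one next to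
    the other, so a free generator is also a conjugate of [gn j ^+ 2].  This
    form makes commutation with the generators below [j] visible. *)
Lemma xg_desc i j : i < k.-1 -> j <= i ->
  xg i j = (gn j ^+ 2) ^ desc j.+1 i.+1.
Proof.
move=> ik; move e: (i - j)%N => d; elim: d j e => [|d IHd] j e ji.
  have -> : j = i by lia.
  by rewrite /xg !desc_nil // invg1 !conjg1.
have lt : j < i by lia.
have -> : xg i j = xg i j.+1 ^ gn j.
  by rewrite /xg (desc_recl lt) invgM invgK conjgM.
rewrite IHd //; last by lia.
have C : commute (gn j) (desc j.+2 i.+1).
  by apply: desc_commute => b bj; apply: gn_commute; lia.
rewrite -conjgM -C [desc j.+1 _]desc_recl // !conjgM; congr (_ ^ _).
by rewrite !conjXg (braid_rel_conj (gn_near _)) //; lia.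
Qed.

Lemma xg_down i j : j < i -> xg i j.+1 ^ gn j = xg i j.
Proof. by move=> lt; rewrite /xg (desc_recl lt) invgM invgK conjgM. Qed.

(** For [a] above [j] the conjugator turns [gn a] into [gn a.-1], which is far
    from the squared generator [gn i ^+ 2]. *)
Lemma xg_far i j a : i < k.-1 -> j <= i -> a < i -> a != j -> a.+1 != j ->
  xg i j ^ gn a = xg i j.
Proof.
move=> ik ji ai aj aj1.
suff C : commute (gn a) (xg i j) by rewrite conjgE -C mulKg.
have [lt|ge] := ltnP a j.
  have C1 : commute (gn a) (desc j.+1 i.+1).
    by apply: desc_commute => b bj; apply: gn_commute; lia.
  have C2 : commute (gn a) (gn j) by apply: gn_commute; lia.
  rewrite xg_desc // conjgE.
  by do !apply: commuteM; try exact: commuteX; try exact: commuteV.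
have e : gn a = gn a.-1 ^ (desc j i)^-1.
  rewrite conjgE invgK mulgA -desc_shift ?mulgK //; lia.
have C : commute (gn a.-1) (gn i ^+ 2).
  by apply: commuteX; apply: gn_commute; lia.
by rewrite /commute /xg {1 2}e -!conjMg C.
Qed.

(** The product is the loop around the two strands [a] and [a.+1] together,
    which does not see them cross.  Algebraically it is a conjugate of
    [t s s t], with [s = gn a] and [t = gn a.+1], by a braid commuting with
    [s]. *)
Lemma xg_prod_fixed i a : i < k.-1 -> a < i ->
  (xg i a * xg i a.+1) ^ gn a = xg i a * xg i a.+1.
Proof.
move=> ik ai.
have C : commute (gn a) (desc a.+2 i.+1).
  by apply: desc_commute => b bj; apply: gn_commute; lia.
have e : gn a = gn a ^ desc a.+2 i.+1 by rewrite conjgE C mulKg.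
rewrite !xg_desc ?(ltnW ai) // [desc a.+1 _]desc_recl // conjgM -conjMg.
rewrite {2}e -conjJg; congr (_ ^ _).
have -> : (gn a ^+ 2) ^ (gn a.+1)^-1 * gn a.+1 ^+ 2
    = gn a.+1 * gn a * gn a * gn a.+1.
  by rewrite conjgE !expg2 invgK -!mulgA mulKg.
by rewrite conjgE -(braid_rel_commute (gn_near _)) ?mulKg //; lia.
Qed.

Lemma xg_up i a : i < k.-1 -> a < i ->
  xg i a ^ gn a = xg i a * xg i a.+1 * (xg i a)^-1.
Proof.
move=> ik ai; apply: (mulIg (xg i a)).
by rewrite mulgVK -{2}(xg_down ai) -conjMg xg_prod_fixed.
Qed.

End BraidGenerators.

(** * Spans over a set of central scalars *)

Local Open Scope ring_scope.

(** The coefficient ring may be zero, and with it the group algebra, so the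
    scalars are taken inside the ring itself, as a set of central elements
    containing [-1]. *)
Section CentralSpan.
Context (A : pzRingType) (Z : A -> Prop).
Hypothesis Z_central : forall c, Z c -> forall x, c * x = x * c.
Hypothesis Z_N1 : Z (-1).
Implicit Types (S T U : A -> Prop) (u v x y : A).

Inductive cspan S : A -> Prop :=
| cspan_in u of S u : cspan S u
| cspan0 : cspan S 0
| cspanD u v of cspan S u & cspan S v : cspan S (u + v)
| cspanZ c u of Z c & cspan S u : cspan S (c * u).

Lemma cspanN S u : cspan S u -> cspan S (- u).
Proof. by rewrite -mulN1r; apply: cspanZ. Qed.

Lemma cspanB S u v : cspan S u -> cspan S v -> cspan S (u - v).
Proof. by move=> Su Sv; apply: cspanD => //; apply: cspanN. Qed.

Lemma cspan_mull S U x :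
  (forall s, S s -> cspan U (x * s)) -> forall y, cspan S y -> cspan U (x * y).
Proof.
move=> SU y; elim=> {y} [u /SU //||u v _ IHu _ IHv|c u Zc _ IHu].
- by rewrite mulr0; apply: cspan0.
- by rewrite mulrDr; apply: cspanD.
by rewrite mulrA -(Z_central Zc) -mulrA; apply: cspanZ.
Qed.

Lemma cspan_mulr S U y :
  (forall s, S s -> cspan U (s * y)) -> forall x, cspan S x -> cspan U (x * y).
Proof.
move=> SU x; elim=> {x} [u /SU //||u v _ IHu _ IHv|c u Zc _ IHu].
- by rewrite mul0r; apply: cspan0.
- by rewrite mulrDl; apply: cspanD.
by rewrite -mulrA; apply: cspanZ.
Qed.

Lemma cspan_mul S T U :
  (forall s t, S s -> T t -> cspan U (s * t)) ->
  forall x y, cspan S x -> cspan T y -> cspan U (x * y).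
Proof.
move=> STU x y Sx Ty; apply: cspan_mulr Sx => s Ss.
by apply: cspan_mull Ty => t; apply: STU.
Qed.

Lemma cspan_sub S T : (forall s, S s -> cspan T s) ->
  forall x, cspan S x -> cspan T x.
Proof.
move=> ST x Sx; rewrite -[x]mul1r; apply: cspan_mull Sx => s.
by rewrite mul1r; apply: ST.
Qed.

End CentralSpan.

Lemma commutator_aug (B : pzRingType) (x y : B) :
  (x - 1) * (y - 1) - (y - 1) * (x - 1) = x * y - y * x.
Proof.
have e (u v : B) : (u - 1) * (v - 1) = u * v - (u + v - 1).
  by rewrite mulrBl mulrBr mulr1 mul1r -[u + v - 1]addrA [- (u + _)]opprD addrA.
rewrite !e [y + x]addrC; move: (x + y - 1) => c.
by rewrite opprB addrA subrK.
Qed.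

(** * Singular braids over an arbitrary ring *)

(** The group algebra enters only through its scalars and the multiplicative
    map [ga] that embeds the braid group in it. *)
Section SingularBraids.
Context (k : nat) (A : pzRingType) (Z : A -> Prop).
Hypothesis Z_central : forall c, Z c -> forall x, c * x = x * c.
Hypothesis Z_N1 : Z (-1).
Context (ga : braid k -> A).
Hypothesis ga1 : ga 1%g = 1.
Hypothesis gaM : forall g h, ga (g * h)%g = ga g * ga h.
Implicit Types (a i j m n : nat) (g f h r : braid k) (u v e x : A).
Local Notation span := (cspan Z).
Local Notation mull := (@cspan_mull A Z Z_central).
Local Notation mul := (@cspan_mul A Z Z_central).

Lemma gaVK g x : ga g^-1%g * (ga g * x) = x.
Proof. by rewrite mulrA -gaM mulVg ga1 mul1r. Qed.

Definition xfree i : braid k -> Prop :=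
  gen_by (fun g => exists2 j, (j <= i)%N & g = xg k i j).

Lemma xfree_xg i j : (j <= i)%N -> xfree i (xg k i j).
Proof. by move=> ji; apply: gen_by_gen; exists j. Qed.

(** Free singular braids with [n] double points, as lists of factors; their
    span is the [n]-th power of the augmentation ideal of the free group. *)
Inductive free_word i : nat -> A -> Prop :=
| free_word1 : free_word i 0 1
| free_wordF n f u of xfree i f & free_word i n u : free_word i n (ga f * u)
| free_wordX n j u of (j <= i)%N & free_word i n u :
    free_word i n.+1 ((ga (xg k i j) - 1) * u).

Definition free_span i n := span (free_word i n).

Lemma free_wordM i m n u v : free_word i m u -> free_word i n v ->
  free_word i (m + n) (u * v).
Proof.
move=> Eu Ev; elim: Eu => [|{}m f {}u Ff _ IH|{}m j {}u ji _ IH].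
- by rewrite mul1r.
- by rewrite -mulrA; apply: free_wordF.
by rewrite -mulrA addSn; apply: free_wordX.
Qed.

Lemma free_spanM i m n u v : free_span i m u -> free_span i n v ->
  free_span i (m + n) (u * v).
Proof.
by apply: mul => {u v} u v Eu Ev; apply/cspan_in/free_wordM.
Qed.

Lemma free_span_of i f : xfree i f -> free_span i 0 (ga f).
Proof.
move=> Ff; rewrite -[ga f]mulr1; apply/cspan_in/free_wordF => //.
exact: free_word1.
Qed.

Lemma free_span_x i j : (j <= i)%N -> free_span i 1 (ga (xg k i j) - 1).
Proof.
move=> ji; rewrite -[_ - 1]mulr1; apply/cspan_in/free_wordX => //.
exact: free_word1.
Qed.

(** The augmentation ideal is generated by the [x - 1] with [x] a generator:
    [f g - 1 = (f - 1) g + (g - 1)] and [f^-1 - 1 = - f^-1 (f - 1)]. *)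
Lemma free_span_aug i f : xfree i f -> free_span i 1 (ga f - 1).
Proof.
elim=> {f} [f [j ji ->]||f g Ff IHf Fg IHg|f Ff IHf].
- exact: free_span_x.
- by rewrite ga1 subrr; apply: cspan0.
- have -> : ga (f * g)%g - 1 = (ga f - 1) * ga g + (ga g - 1).
    by rewrite gaM mulrBl mul1r addrA subrK.
  apply: cspanD => //; rewrite -[1%N]addn0; apply: free_spanM => //.
  exact: free_span_of.
have -> : ga f^-1%g - 1 = - (ga f^-1%g * (ga f - 1)).
  by rewrite mulrBr -gaM mulVg mulr1 ga1 opprB.
apply: cspanN => //; rewrite -[1%N]add0n; apply: free_spanM => //.
exact/free_span_of/gen_by_V.
Qed.

(** Conjugate elements of the free group agree modulo the square of the
    augmentation ideal, as [f g - g f] is the commutator of [f - 1] and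
    [g - 1]. *)
Lemma free_span_conj i f g : xfree i f -> xfree i g ->
  free_span i 2 (ga (f ^ g)%g - ga f).
Proof.
move=> Ff Fg.
have -> : ga (f ^ g)%g - ga f = ga g^-1%g *
    ((ga f - 1) * (ga g - 1) - (ga g - 1) * (ga f - 1)).
  by rewrite commutator_aug mulrBr gaVK conjgE !gaM.
rewrite -[2%N]add0n; apply: free_spanM; first exact/free_span_of/gen_by_V.
by apply: cspanB => //; rewrite -[2%N]/(1 + 1)%N; apply: free_spanM;
   apply: free_span_aug.
Qed.

Lemma free_span_subC i n u v : free_span i n (u - v) -> free_span i n (v - u).
Proof. by move=> /(cspanN Z_N1); rewrite opprB. Qed.

(** Up to conjugation in the free group, [gn a] and its inverse both exchange
    the generators of index [a] and [a.+1] and fix the others.  When one of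
    them sends a generator to a conjugate of another, the other sends it to that
    generator itself. *)
Lemma xg_conj i j a : (i < k.-1)%N -> (j <= i)%N -> (a < i)%N ->
  [/\ xfree i (xg k i j ^ gn k a)%g, xfree i (xg k i j ^ (gn k a)^-1)%g &
      free_span i 2 (ga (xg k i j ^ gn k a)%g - ga (xg k i j ^ (gn k a)^-1)%g)].
Proof.
move=> ik ji ai; have Fx b : (b <= i)%N -> xfree i (xg k i b) := @xfree_xg i b.
have FJ f g : xfree i f -> xfree i g -> xfree i (f ^ g)%g.
  move=> Ff Fg; rewrite conjgE; apply: gen_by_M; first exact: gen_by_V.
  exact: gen_by_M.
have [->|ja] := eqVneq j a.
  have e1 : (xg k i a ^ gn k a)%g = (xg k i a.+1 ^ (xg k i a)^-1)%g.
    by rewrite xg_up // conjgE invgK -mulgA.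
  have e2 : (xg k i a ^ (gn k a)^-1)%g = xg k i a.+1.
    by rewrite -(xg_down _ ai) conjgK.
  rewrite e1 e2; have := Fx _ ai; have := gen_by_V (Fx _ (ltnW ai)).
  by move=> F1 F2; split=> //; [apply: FJ | apply: free_span_conj].
have [->|ja1] := eqVneq j a.+1.
  have e1 : (xg k i a.+1 ^ gn k a)%g = xg k i a by rewrite xg_down.
  have e2 : (xg k i a.+1 ^ (gn k a)^-1)%g = (xg k i a ^ xg k i a.+1)%g.
    apply: (mulgI (xg k i a.+1)); rewrite -conjgC.
    rewrite -{1}[xg k i a.+1](conjgK (gn k a)).
    rewrite xg_down //.
    by rewrite -conjMg -{1}(xg_prod_fixed ik ai) conjgK.
  rewrite e1 e2; have := Fx _ ai; have := Fx _ (ltnW ai).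
  move=> F1 F2; split=> //; first exact: FJ.
  exact/free_span_subC/free_span_conj.
have e1 : (xg k i j ^ gn k a)%g = xg k i j.
  by apply: xg_far => //; rewrite eq_sym.
have e2 : (xg k i j ^ (gn k a)^-1)%g = xg k i j by rewrite -{1}e1 conjgK.
by rewrite e1 e2 subrr; split; try exact: Fx; apply: cspan0.
Qed.

Lemma xfree_conj i f a : (i < k.-1)%N -> (a < i)%N -> xfree i f ->
  xfree i (f ^ gn k a)%g /\ xfree i (f ^ (gn k a)^-1)%g.
Proof.
move=> ik ai; elim=> {f} [f [j ji ->]||f g _ [f1 f2] _ [g1 g2]|f _ [f1 f2]].
- by case: (xg_conj ik ji ai).
- by rewrite !conj1g; split; apply: gen_by_1.
- by rewrite !conjMg; split; apply: gen_by_M.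
by rewrite !conjVg; split; apply: gen_by_V.
Qed.

Definition cj g u := ga g^-1%g * u * ga g.

Lemma cjM g u v : cj g (u * v) = cj g u * cj g v.
Proof.
by rewrite /cj !mulrA -[_ * _ * ga g^-1%g]mulrA -gaM mulgV ga1 mulr1.
Qed.

Lemma cj_of g f : cj g (ga f) = ga (f ^ g)%g.
Proof. by rewrite /cj conjgE mulgA !gaM. Qed.

Lemma cj1 g : cj g 1 = 1.
Proof. by rewrite -ga1 cj_of conj1g. Qed.

Lemma cjB g u v : cj g (u - v) = cj g u - cj g v.
Proof. by rewrite /cj mulrBr mulrBl. Qed.

(** An automorphism acting trivially on the abelianisation of a free group acts
    trivially on the graded pieces of its augmentation filtration.  The
    difference of the two conjugations is handled factor by factor, with
    [x1 y1 - x2 y2 = (x1 - x2) y1 + x2 (y1 - y2)]. *)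
Lemma free_word_cj i n a u : (i < k.-1)%N -> (a < i)%N -> free_word i n u ->
  [/\ free_span i n (cj (gn k a) u), free_span i n (cj (gn k a)^-1%g u) &
      free_span i n.+1 (cj (gn k a) u - cj (gn k a)^-1%g u)].
Proof.
move=> ik ai; set s := gn k a.
have mulB_split (x1 x2 y1 y2 : A) :
    x1 * y1 - x2 * y2 = (x1 - x2) * y1 + x2 * (y1 - y2).
  by rewrite mulrBl mulrBr addrA subrK.
elim=> {n u} [|n f u Ff _ [IH1 IH2 IHd]|n j u ji _ [IH1 IH2 IHd]].
- rewrite !cj1 subrr; split; try apply: cspan0;
    by apply: cspan_in; apply: free_word1.
- have [F1 F2] := xfree_conj ik ai Ff.
  rewrite !cjM !cj_of; split.
  + by rewrite -[n]add0n; apply: free_spanM => //; apply: free_span_of.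
  + by rewrite -[n]add0n; apply: free_spanM => //; apply: free_span_of.
  rewrite mulB_split; apply: cspanD.
    rewrite -add1n; apply: free_spanM => //.
    rewrite -[ga (f ^ s)%g](subrK 1) -addrA -[1 - _]opprB.
    by apply: cspanB => //; apply: free_span_aug.
  by rewrite -[n.+1]add0n; apply: free_spanM => //; apply: free_span_of.
have [F1 F2 Fd] := xg_conj ik ji ai.
have /free_span_aug A1 := F1; have /free_span_aug A2 := F2.
rewrite !cjM !cjB !cj_of !cj1; split.
- by rewrite -add1n; apply: free_spanM.
- by rewrite -add1n; apply: free_spanM.
rewrite mulB_split; apply: cspanD.
  rewrite -[n.+2]/(2 + n)%N; apply: free_spanM => //.
  by rewrite opprB addrA subrK.
by rewrite -[n.+2]/(1 + n.+1)%N; apply: free_spanM.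
Qed.

(** * Splitting off the free part of a singular word *)

(** The value of a letter of given shape at a braid: [Some true] and
    [Some false] are the crossings and [None] the double point.  Moving the
    shape from one braid to another treats the three cases at once. *)
Definition shape_val (o : option bool) g : A :=
  match o with
  | Some true => ga g
  | Some false => ga g^-1%g
  | None => ga g - ga g^-1%g
  end.

Lemma shape_val_intertwine o g h r : (g * r = r * h)%g ->
  shape_val o g * ga r = ga r * shape_val o h.
Proof.
move=> e; have e' : (g^-1 * r = r * h^-1)%g.
  by apply: (mulgI g); rewrite mulVKg mulgA e mulgK.
by case: o => [[]|] /=; rewrite ?mulrBl ?mulrBr -!gaM ?e ?e'.
Qed.

Definition letter_shape (l : singular_letter k) : option bool :=
  match l with Crossing b _ => Some b | DoublePoint _ => None end.

Definition letter_idx (l : singular_letter k) : 'I_k.-1 :=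
  match l with Crossing _ i | DoublePoint i => i end.

Definition mkletter (o : option bool) (i : 'I_k.-1) : singular_letter k :=
  match o with Some b => Crossing b i | None => DoublePoint i end.

Implicit Types (w : seq (singular_letter k)) (l : singular_letter k)
  (p q : 'S_k).

Definition lval l : A := shape_val (letter_shape l) (gn k (letter_idx l)).
Definition wval w : A := \prod_(l <- w) lval l.
Definition wperm w : 'S_k := (\prod_(l <- w) letter_perm l)%g.
Definition lower i w := all (fun l => letter_idx l < i)%N w.

Lemma letter_permE l : letter_perm l = braid_perm (gn k (letter_idx l)).
Proof. by case: l => [b i|i]; rewrite /= gn_sigma braid_perm_sigma. Qed.

Lemma letter_perm_inv l : (letter_perm l * letter_perm l = 1)%g.
Proof. by case: l => [b i|i]; rewrite /= /adj_tperm tperm2. Qed.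

Lemma wval_cons l w : wval (l :: w) = lval l * wval w.
Proof. by rewrite /wval big_cons. Qed.

Lemma wperm_cons l w : wperm (l :: w) = (letter_perm l * wperm w)%g.
Proof. by rewrite /wperm big_cons. Qed.

(** The permutation [p] is part of the data so that purity can be read off the
    terms of a combination; free words are pure, so it comes from [w]. *)
Definition free_lower i n p u := exists a e w,
  [/\ free_word i a e, lower i w, (a + count (@is_double k) w)%N = n,
      wperm w = p & u = e * wval w].

Definition free_lower_span i n p := span (free_lower i n p).

Lemma free_lower_spanM i m n p u v : free_span i m u ->
  free_lower_span i n p v -> free_lower_span i (m + n) p (u * v).
Proof.
apply: mul => {u v} e _ Ee [b [e' [w [Ee' lw <- <- ->]]]].
apply: cspan_in; exists (m + b)%N, (e * e'), w; rewrite addnA mulrA.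
by split=> //; apply: free_wordM.
Qed.

Lemma lower_word_free i w : lower i w ->
  free_lower_span i (count (@is_double k) w) (wperm w) (wval w).
Proof.
move=> lw; apply: cspan_in; exists 0%N, 1, w; rewrite mul1r; split=> //.
exact: free_word1.
Qed.

(** Letters on the strands [0, ..., i] move past free words.  For a double
    point this is the displayed identity of the introduction, and its second
    term trades the double point of the letter for one more in the free
    word. *)
Lemma letter_free_lower i n p l u : (i < k.-1)%N -> (letter_idx l < i)%N ->
  free_lower_span i n p u ->
  free_lower_span i (is_double l + n) (letter_perm l * p) (lval l * u).
Proof.
move=> ik li; apply: mull => {u} _ [m [e [w [Ee lw <- <- ->]]]].
have [J1 J2 Jd] := free_word_cj ik li Ee.
have cjE g : ga g * e = cj g^-1%g e * ga g.
  by rewrite /cj invgK -mulrA -gaM mulVg ga1 mulr1.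
have pl b : letter_perm (Crossing b (letter_idx l)) = letter_perm l.
  by case: l {li J1 J2 Jd}.
have signed b :
    free_lower_span i (count (@is_double k) w) (letter_perm l * wperm w)
      (ga (if b then gn k (letter_idx l) else (gn k (letter_idx l))^-1)%g
       * wval w).
  have := @lower_word_free i (Crossing b (letter_idx l) :: w).
  rewrite wval_cons wperm_cons pl /lval /= li add0n => /(_ lw).
  by case: b.
have double : l = DoublePoint (letter_idx l) ->
    free_lower_span i (count (@is_double k) w).+1 (letter_perm l * wperm w)
      (lval l * wval w).
  move=> el; have dl : is_double l by rewrite el.
  have := @lower_word_free i (l :: w).
  by rewrite wval_cons wperm_cons /= li dl => /(_ lw).
case: l li J1 J2 Jd signed double {pl} 
  => [b j|j] /= lj J1 J2 Jd signed double; rewrite mulrA.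
  rewrite add0n /lval /=; case: b {double} => /=.
    by rewrite cjE -mulrA; apply: free_lower_spanM => //; apply: (signed true).
  rewrite cjE invgK -mulrA; apply: free_lower_spanM => //.
  exact: (signed false).
have -> : lval (DoublePoint j) * e * wval w =
    cj (gn k j)^-1%g e * (lval (DoublePoint j) * wval w)
    - (cj (gn k j) e - cj (gn k j)^-1%g e) * (ga (gn k j)^-1%g * wval w).
  rewrite /lval /= !mulrA -mulrBl; congr (_ * _).
  rewrite mulrBl !cjE invgK mulrBr mulrBl opprB addrA subrK.
  by [].
apply: cspanB => //.
  by rewrite addnCA; apply: free_lower_spanM => //; apply: double.
by rewrite add1n -addSn; apply: free_lower_spanM => //; apply: (signed false).
Qed.

Definition coset_word i n p u := exists j q v,
  [/\ (j <= i.+1)%N, free_lower_span i n q v,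
      p = (braid_perm (desc k j i.+1) * q)%g & u = ga (desc k j i.+1) * v].

Definition coset_span i n p := span (coset_word i n p).

Lemma coset_in i j n q v : (j <= i.+1)%N -> free_lower_span i n q v ->
  coset_span i n (braid_perm (desc k j i.+1) * q) (ga (desc k j i.+1) * v).
Proof. by move=> ji Tv; apply: cspan_in; exists j, q, v. Qed.

Lemma desc_xg i a : (i < k.-1)%N -> (a <= i)%N ->
  (gn k a * desc k a.+1 i.+1 = desc k a i.+1 * xg k i a)%g.
Proof.
move=> ik ai; rewrite xg_desc // [desc k a _]desc_recl // conjgE expg2.
by rewrite -!mulgA mulVKg mulKg.
Qed.

(** With [a] the index of the letter, the cases are [a.+1 < j] and [j < a],
    where it passes through [r_j] unchanged or shifted by one; and [j = a],
    [j = a.+1], where it exchanges [r_a] and [r_a.+1] up to [x = xg k i a].  In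
    the last two a double point becomes [r_a.+1 (1 - x^-1)] or
    [r_a (x - 1)]. *)
Lemma letter_coset i n p l u : (i < k.-1)%N -> (letter_idx l < i.+1)%N ->
  coset_span i n p u ->
  coset_span i (is_double l + n) (letter_perm l * p) (lval l * u).
Proof.
move=> ik li; apply: mull => {u} _ [j [q [v [ji Tv -> ->]]]].
set a : nat := letter_idx l in li *.
have [aj | [ja | [e | e]]] :
  (a.+1 < j)%N \/ (j < a)%N \/ j = a \/ j = a.+1 by lia.
- have ai : (a < i)%N by lia.
  have C : (gn k a * desc k j i.+1 = desc k j i.+1 * gn k a)%g.
    by apply: desc_commute => b bj; apply: gn_commute; lia.
  rewrite mulrA (shape_val_intertwine _ C) -mulrA mulgA letter_permE.
  rewrite -braid_permM C braid_permM -mulgA -letter_permE; apply: coset_in => //.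
  exact: letter_free_lower.
- have a1k : (a.-1 < k.-1)%N by lia.
  pose l' := mkletter (letter_shape l) (Ordinal a1k).
  have C : (gn k a * desc k j i.+1 = desc k j i.+1 * gn k a.-1)%g.
    by apply: desc_shift.
  have il' : letter_idx l' = a.-1 :> nat by rewrite /l'; case: (letter_shape l).
  have kl' : letter_shape l' = letter_shape l.
    by rewrite /l'; case: (letter_shape l).
  have dl' : is_double l' = is_double l by rewrite /l'; case: (l).
  have vl' : lval l' = shape_val (letter_shape l) (gn k a.-1).
    by rewrite /lval il' kl'.
  rewrite mulrA (shape_val_intertwine _ C) -mulrA mulgA letter_permE.
  rewrite -braid_permM C braid_permM -mulgA -il' -letter_permE -dl' il' -vl'.
  by apply: coset_in => //; apply: letter_free_lower => //; lia.
- have ai : (a <= i)%N by lia.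
  have e1 : (gn k a * desc k a i.+1 = desc k a.+1 i.+1)%g.
    by rewrite desc_recl // mulVKg.
  have e2 : ((gn k a)^-1 * desc k a i.+1 = desc k a.+1 i.+1 * (xg k i a)^-1)%g.
    apply: (mulgI (gn k a)); rewrite mulVKg mulgA desc_xg //.
    by rewrite mulgK.
  have ep : (letter_perm l * (braid_perm (desc k j i.+1) * q)
      = braid_perm (desc k a.+1 i.+1) * q)%g.
    by rewrite e mulgA letter_permE -braid_permM e1.
  have Fx := gen_by_V (xfree_xg ai : xfree i (xg k i a)).
  rewrite ep e mulrA /lval -/a; case: l @a li ai e e1 e2 ep Fx
    => [[] b|b] a li ai e e1 e2 ep Fx /=.
  + rewrite -gaM e1; exact: coset_in.
  + rewrite -gaM e2 gaM -mulrA; apply: coset_in => //.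
    by rewrite -[n]add0n; apply: free_lower_spanM => //; apply: free_span_of.
  rewrite mulrBl -!gaM e1 e2 gaM -[X in X - _]mulr1 -mulrBr -mulrA.
  apply: coset_in => //; apply: free_lower_spanM => //.
  exact/free_span_subC/free_span_aug.
have ai : (a <= i)%N by lia.
have e1 : (gn k a * desc k a.+1 i.+1 = desc k a i.+1 * xg k i a)%g.
  exact: desc_xg.
have e2 : ((gn k a)^-1 * desc k a.+1 i.+1 = desc k a i.+1)%g.
  by rewrite [RHS]desc_recl.
have ep : (letter_perm l * (braid_perm (desc k j i.+1) * q)
    = braid_perm (desc k a i.+1) * q)%g.
  rewrite e; apply: (mulgI (letter_perm l)); rewrite [RHS]mulgA mulgA.
  rewrite letter_perm_inv mul1g letter_permE -braid_permM -/a.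
  by rewrite [desc k a _]desc_recl // mulVKg.
have Fx := xfree_xg ai : xfree i (xg k i a).
rewrite ep e mulrA /lval -/a; case: l @a li ai e e1 e2 ep Fx
  => [[] b|b] a li ai e e1 e2 ep Fx /=.
+ rewrite -gaM e1 gaM -mulrA; apply: coset_in => //; first by lia.
  by rewrite -[n]add0n; apply: free_lower_spanM => //; apply: free_span_of.
+ by rewrite -gaM e2; apply: coset_in => //; lia.
rewrite mulrBl -!gaM e1 e2 gaM -[X in _ - X]mulr1 -mulrBr -mulrA.
apply: coset_in => //; first by lia.
by apply: free_lower_spanM => //; apply: free_span_x.
Qed.

(** * Combing pure words *)

Lemma lower_word_coset i w : (i < k.-1)%N -> lower i.+1 w ->
  coset_span i (count (@is_double k) w) (wperm w) (wval w).
Proof.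
move=> ik; elim: w => [_|l w IHw /= /andP[li lw]].
  have := @coset_in i i.+1 0 1%g 1 (leqnn _).
  rewrite desc_nil // braid_perm1 ga1 !mulr1 mulg1 /wval /wperm !big_nil.
  by apply; have := @lower_word_free i [::] isT; rewrite /wval /wperm !big_nil.
by rewrite wval_cons wperm_cons; apply: letter_coset => //; apply: IHw.
Qed.

Lemma adj_tperm_fix (b : 'I_k.-1) (s : 'I_k) :
  (b.+1 < s)%N -> adj_tperm b s = s.
Proof. by move=> bs; rewrite tpermD // -val_eqE /=; lia. Qed.

Lemma lower_fix i w (s : 'I_k) : lower i w -> (i < s)%N -> wperm w s = s.
Proof.
move=> lw si; elim: w lw => [_|l w IHw /= /andP[li lw]].
  by rewrite /wperm big_nil perm1.
rewrite wperm_cons permM; suff -> : letter_perm l s = s by apply: IHw.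
by case: l li => [b a|a] /= ai; apply: adj_tperm_fix; lia.
Qed.

Lemma desc_move i j (s : 'I_k) :
  (i < k.-1)%N -> (j <= i)%N -> s = i.+1 :> nat ->
  braid_perm (desc k j i.+1) s <> s.
Proof.
move=> ik ji si; have fix_s n : (n <= i)%N -> braid_perm (desc k j n) s = s.
  move=> ni; rewrite /desc big_seq.
  apply: (big_ind (fun g => braid_perm g s = s)).
  - by rewrite braid_perm1 perm1.
  - by move=> g h gs hs; rewrite braid_permM permM gs.
  move=> a; rewrite mem_index_iota => ja.
  have ak : (a < k.-1)%N by lia.
  rewrite braid_permV (gn_sigma (Ordinal ak)) braid_perm_sigma tpermV.
  by apply: adj_tperm_fix => /=; lia.
rewrite /desc big_nat_recr //= -/(desc k j i) braid_permM permM fix_s //.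
rewrite braid_permV (gn_sigma (Ordinal ik)) braid_perm_sigma tpermV /adj_tperm.
have -> : s = Ordinal (lt_pred_strand (Ordinal ik)) by apply: val_inj.
by rewrite tpermR => /(congr1 val) /=; lia.
Qed.

(** For [j <= i] a term [r_j v] with trivial permutation is impossible, since
    [r_j] moves the strand [i.+1] while [v] fixes it. *)
Lemma pure_lower_word i w : (i < k.-1)%N -> lower i.+1 w -> wperm w = 1%g ->
  free_lower_span i (count (@is_double k) w) 1 (wval w).
Proof.
move=> ik lw w1; have := lower_word_coset ik lw; rewrite w1.
apply: cspan_sub => // _ [j [q [v [ji Tv e ->]]]].
have [lt|ge] := ltnP i j.
  have ej : j = i.+1 by lia.
  move: e; rewrite ej desc_nil // braid_perm1 mul1g ga1 mul1r => ->.
  exact: Tv.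
(* The span of an empty set of words lies in every span. *)
apply: mull Tv => t [_ [_ [w' [_ lw' _ eq_q _]]]].
have ik1 : (i.+1 < k)%N by lia.
case: (@desc_move i j (Ordinal ik1)) => //.
apply: (perm_inj (s := q)); rewrite -permM -e perm1.
by rewrite -eq_q (lower_fix lw').
Qed.

Inductive combed_word : nat -> nat -> A -> Prop :=
| combed_word0 : combed_word 0 0 1
| combed_wordS i m n e u of free_word i m e & combed_word i n u :
    combed_word i.+1 (m + n) (e * u).

Lemma pure_word_combed i w : (i <= k.-1)%N -> lower i w -> wperm w = 1%g ->
  span (combed_word i (count (@is_double k) w)) (wval w).
Proof.
elim: i w => [|i IHi] w ik lw w1.
  case: w lw w1 => [_ _|l w /andP[]//]; rewrite /wval big_nil.
  exact/cspan_in/combed_word0.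
have := pure_lower_word ik lw w1; apply: cspan_sub => //.
move=> _ [m [e [w' [Ee lw' <- w'1 ->]]]].
apply: mull (IHi w' (ltnW ik) lw' w'1) => u Cu.
exact/cspan_in/combed_wordS.
Qed.

End SingularBraids.

(** * Descent to the group algebra of the pure braid group *)

Section Descent.
Context (R : comPzRingType) (k : nat).
Local Notation A := (group_algebra R (braid k)).
Local Notation P := (group_algebra R (pure_braid k)).
Local Notation incl := (@pure_incl k R).
Implicit Types (i j m n : nat).

Lemma ga_mulrUU (G : groupType) (a b : R) (g h : G) :
  (<< a *g g >> : group_algebra R G) * (<< b *g h >> : group_algebra R G)
  = << a * b *g (g * h)%g >>.
Proof. exact: ga_mulUU. Qed.

Lemma ga_ofM (G : groupType) (g h : G) :
  ga_of R (g * h)%g = ga_of R g * ga_of R h.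
Proof. by rewrite ga_mulrUU mulr1. Qed.

Lemma ga_of1 (G : groupType) : ga_of R (1%g : G) = 1.
Proof. by []. Qed.

Definition scalar (c : A) : Prop := exists r : R, c = << r *g 1%g >>.

Lemma scalar_central c : scalar c -> forall x, c * x = x * c.
Proof.
move=> [r ->] x; elim/ga_ind: x => [|x y IHx IHy|a g].
- by rewrite mul0r mulr0.
- by rewrite mulrDl mulrDr IHx IHy.
by rewrite !ga_mulrUU mul1g mulg1 mulrC.
Qed.

Lemma scalar_N1 : scalar (-1).
Proof. by exists (-1); rewrite -ga_of1 /ga_of monalgUN. Qed.

Lemma scalarE (G : groupType) (r : R) (x : group_algebra R G) :
  (<< r *g 1%g >> : group_algebra R G) * x = r *: x.
Proof.
elim/ga_ind: x => [|x y IHx IHy|a g].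
- by rewrite mulr0 scaler0.
- by rewrite mulrDr scalerDr IHx IHy.
rewrite ga_mulrUU mul1g; apply/malgP=> h.
by rewrite [RHS]ga_scaleE !mcoeffU mulrnAr.
Qed.

Lemma inclD (x y : P) : incl (x + y) = incl x + incl y.
Proof. exact: ga_mapD. Qed.

Lemma incl_of (g : pure_braid k) : incl (ga_of R g) = ga_of R (val g).
Proof. exact: ga_mapU. Qed.

Lemma incl1 : incl 1 = 1.
Proof. by rewrite -ga_of1 incl_of. Qed.

Lemma inclB (x y : P) : incl (x - y) = incl x - incl y.
Proof.
by have := inclD (x - y) y; rewrite subrK => e; rewrite [incl x]e addrK.
Qed.

Lemma incl_aug (g : pure_braid k) : incl (ga_of R g - 1) = ga_of R (val g) - 1.
Proof.
rewrite inclB; exact: (congr2 (fun y z => y - z) (incl_of g) incl1).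
Qed.

Lemma inclZ (r : R) (x : P) : incl (r *: x) = r *: incl x.
Proof.
rewrite -[r *: x]scalarE -[RHS]scalarE pure_inclM; congr (_ * _).
by rewrite /pure_incl ga_mapU.
Qed.

Lemma x_braid_xg (i : 'I_k.-1) (j : 'I_i.+1) : x_braid j = xg k i j.
Proof.
rewrite /x_braid.
have -> : (\prod_(a < k.-1 | (j <= a < i)%N) (sigma a)^-1)%g = desc k j i.
  rewrite /desc (big_nat_widen _ _ _ _ _ (ltnW (ltn_ord i))) big_geq_mkord.
  by apply: eq_big => [a|a _]; rewrite ?gn_sigma //= andbC.
by rewrite /xg conjgE invgK gn_sigma -mulgA.
Qed.

Lemma xfree_lift (i : 'I_k.-1) (f : braid k) : xfree i f ->
  exists2 g, i_free i g & val g = f.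
Proof.
elim=> {f} [f [j ji ->]||f h _ [f' Ff <-] _ [h' Fh <-]|f _ [f' Ff <-]].
- rewrite -ltnS in ji; exists (x_gen (Ordinal ji)).
    by apply: gen_by_gen; exists (Ordinal ji).
  by rewrite /= x_braid_xg.
- by exists 1%g; first exact: gen_by_1.
- by exists (f' * h')%g; first exact: gen_by_M.
by exists f'^-1%g; first exact: gen_by_V.
Qed.

(** Prepending a factor shifts the indexing families by one; [unlift ord0]
    separates the new first entry from the old ones. *)
Lemma free_word_lift (i : 'I_k.-1) n (u : A) : free_word (ga_of R) i n u ->
  exists2 y : P, i_free_singular i n y & incl y = u.
Proof.
elim=> {n u} [|n f u /xfree_lift[g Fg <-] _ [y [j [w [Fw yE]]] <-]
              |n j u ji _ [y [j' [w [Fw yE]]] <-]].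
- exists 1; last exact: incl1.
  exists (fun=> ord0), (fun=> 1%g); split=> [_|]; first exact: gen_by_1.
  by rewrite big_ord0 mulr1 ga_of1.
- exists (ga_of R g * y); last by rewrite -incl_of pure_inclM.
  exists j, (fun m : 'I_n.+1 =>
    if unlift ord0 m is Some _ then w m else (g * w ord0)%g).
  split=> [m|].
    by case: unlift => [_|]; [exact: Fw | exact: gen_by_M Fg (Fw _)].
  rewrite unlift_none (ga_ofM g) -mulrA yE.
  do 2 apply: (congr1 (fun z => _ * z)).
  by apply: eq_bigr => m _; rewrite liftK; reflexivity.
rewrite -ltnS in ji.
exists ((ga_of R (x_gen (Ordinal ji)) - 1) * y).
  2: by rewrite pure_inclM incl_aug /= x_braid_xg.
exists (fun m : 'I_n.+1 =>
    if unlift ord0 m is Some m' then j' m' else Ordinal ji),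
  (fun m : 'I_n.+2 => if unlift ord0 m is Some m' then w m' else 1%g).
split=> [m|].
  by case: unlift => [m'|]; [exact: Fw | exact: gen_by_1].
rewrite unlift_none ga_of1 mul1r yE big_ord_recl unlift_none liftK -mulrA.
do 2 apply: (congr1 (fun z => _ * z)).
by apply: eq_bigr => m _; rewrite !liftK; reflexivity.
Qed.

(** Families indexed by [nat] can be extended by one strand without changing
    type; at [i = k.-1] their product is the one over [rev_ord]. *)
Lemma combed_word_lift i n (u : A) : (i <= k.-1)%N ->
  combed_word (ga_of R) i n u ->
  exists (d : nat -> nat) (B : nat -> P),
    [/\ forall b : 'I_k.-1, (b < i)%N -> i_free_singular b (d b) (B b),
        (\sum_(b < i) d b)%N = n
      & incl (\prod_(b < i) B (i - b.+1)%N) = u].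
Proof.
move=> + Cu; elim: Cu => {i n u} [_|i m n e u Ee _ IHu ik].
  by exists (fun=> 0%N), (fun=> 1); rewrite !big_ord0 incl1.
have [d [B [FB sum_d <-]]] := IHu (ltnW ik).
have [y Fy <-] := free_word_lift (Ee : free_word _ (Ordinal ik) _ _).
exists (fun b => if b == i then m else d b),
  (fun b => if b == i then y else B b).
split=> [b bi||].
- case: eqP => [bE|/eqP bNi]; last by apply: FB; lia.
  by have -> : b = Ordinal ik by apply: val_inj.
- rewrite big_ord_recr /= eqxx addnC; congr (_ + _)%N; rewrite -sum_d.
  by apply: eq_bigr => b _; rewrite ltn_eqF.
rewrite big_ord_recl /= subSS subn0 eqxx pure_inclM; congr (_ * incl _).
apply: eq_bigr => b _; rewrite /bump /= add1n subSS ifN //.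
by have := ltn_ord b; lia.
Qed.

Lemma combed_span n (u : A) :
  cspan scalar (combed_word (ga_of R) k.-1 n) u ->
  exists (m : nat) (c : 'I_m -> R) (b : 'I_m -> P),
    (forall a, combed n (b a)) /\ u = incl (\sum_(a < m) c a *: b a).
Proof.
elim=> {u} [u Cu||u v _ [m [c [b [Cb ->]]]] _ [m' [c' [b' [Cb' ->]]]]
           |_ u [r ->] _ [m [c [b [Cb ->]]]]].
- have [d [B [FB sum_d <-]]] := combed_word_lift (leqnn _) Cu.
  exists 1%N, (fun=> 1), (fun=> \prod_(b < k.-1) B (k.-1 - b.+1)%N).
  split=> [_|]; last by rewrite big_ord1 scale1r.
  by exists d, B; split=> // b; apply: FB.
- exists 0%N, (fun=> 0), (fun=> 0); rewrite big_ord0; split=> [[]//|].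
  by rewrite /pure_incl ga_map0.
- exists (m + m')%N,
    (fun a => match split a with inl x => c x | inr x => c' x end),
    (fun a => match split a with inl x => b x | inr x => b' x end).
  split=> [a|]; first by case: split.
  rewrite -[LHS]inclD; apply: (congr1 incl); rewrite big_split_ord /=.
  apply: (congr2 (fun y z => y + z)); apply: eq_bigr => a _.
    by rewrite (unsplitK (inl a)).
  by rewrite (unsplitK (inr a)).
exists m, (fun a => r * c a), b; split=> //.
rewrite scalarE -inclZ; apply: (congr1 incl); rewrite scaler_sumr.
by apply: eq_bigr => a _; rewrite scalerA.
Qed.

Lemma lval_letter_val (l : singular_letter k) :
  lval (ga_of R) l = letter_val R l.
Proof. by case: l => [[] i|i]; rewrite /lval /= gn_sigma. Qed.

End Descent.

Theorem theorem1 (R : comPzRingType) (k n : nat) (k_ge1 : (1 <= k)%N)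
    (x : group_algebra R (pure_braid k)) (sing_x : singular_pure_braid n x) :
  exists (m : nat) (c : 'I_m -> R)
         (b : 'I_m -> group_algebra R (pure_braid k)),
    (forall a : 'I_m, combed n (b a)) /\ x = \sum_(a < m) c a *: b a.
Proof.
have [w [w1 <- xE]] := sing_x.
have lw : lower k.-1 w by elim: (w) => //= l w' ->; rewrite ltn_ord.
have := pure_word_combed (@scalar_central R k) (@scalar_N1 R k)
  (ga_of1 R (braid k)) (@ga_ofM R (braid k)) (leqnn _) lw w1.
move=> /combed_span[m [c [b [Cb e]]]]; exists m, c, b; split=> //.
apply: (@pure_incl_inj k R); rewrite xE -e /wval.
by apply: eq_bigr => l _; rewrite lval_letter_val.
Qed.
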